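(* Fix $T>0$ and let $(\mathbb X_t)_{t\in[0,T]}$ be an $\mathcal S$-valued $\mathcal U$-polynomial process with initial value $\mathbf x_0$ and operator $\mathcal L$ of $\mathcal U$-polynomial type with associated map $L:\mathcal U\to\mathcal S^*$. Fix $\mathbf u\in\mathcal U$ and suppose that the extended-tensor-algebra-valued linear ODE (understood componentwise) $$\mathbf c(t)=\mathbf u+\int_0^tL(\mathbf c(s))\,ds$$ admits a $\mathcal U$-valued solution $(\mathbf c(t))_{t\in[0,T]}$ such that $\int_0^T|L(\mathbf c(t))|_{\mathbf x}\,dt<\infty$ for all $\mathbf x\in\mathcal S$. If $$\mathbb E\Big[\sup_{s,t\le T}|\langle\mathbf c(s),\mathbb X_t\rangle|\Big]<\infty\quad\text{and}\quad\mathbb E\Big[\sup_{s,t\le T}|\langle L(\mathbf c(s)),\mathbb X_t\rangle|\Big]<\infty,$$ then $\mathbb E[\langle\mathbf u,\mathbb X_T\rangle]=\langle\mathbf c(T),\mathbf x_0\rangle$.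
   Context: $T((\mathbb R^d))$ is the set of sequences $\mathbf a=(a_0,a_1,\dots)$ with $a_n\in(\mathbb R^d)^{\otimes n}$, $(\mathbb R^d)^{\otimes0}=\mathbb R$. For a multi-index $I=(i_1,\dots,i_n)\in\{1,\dots,d\}^n$, $|I|=n$ (the empty index has length $0$), $e_I=e_{i_1}\otimes\cdots\otimes e_{i_n}$, and $\mathbf a_I=\langle e_I,\mathbf a\rangle$ is the coefficient of $e_I$; $\pi_n(\mathbf a)=a_n$; $\langle\cdot,\cdot\rangle$ on $(\mathbb R^d)^{\otimes n}$ is the bilinear form for which $\{e_I:|I|=n\}$ is orthonormal (extended bilinearly to the complexification). State space and dual: $\mathcal S\subseteq T((\mathbb R^d))$ is a subset with the trace of the product sigma-algebra. $\Pi=\{\Pi_1,\Pi_2,\dots\}$ is a fixed partition of the set of all multi-indices such that each $\Pi_k$ contains only indices of the same length. For $\mathbf x\in\mathcal S$ and $\mathbf u\in T((\mathbb R^d))+\mathrm iT((\mathbb R^d))$, $|\mathbf u|_{\mathbf x}:=\sum_{k\ge1}|\sum_{I\in\Pi_k}\mathbf u_I\mathbf x_I|$; $\mathcal S^*:=\{\mathbf u\in T((\mathbb R^d))+\mathrm iT((\mathbb R^d)):|\mathbf u|_{\mathbf x}<\infty\ \forall\mathbf x\in\mathcal S\}$; for $\mathbf u\in\mathcal S^*$, $\mathbf x\in\mathcal S$: $\langle\mathbf u,\mathbf x\rangle:=\lim_{N\to\infty}\sum_{n=0}^N\langle\pi_n(\mathbf u),\pi_n(\mathbf x)\rangle$.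 Martingale problem: let $M(\mathcal S)$ be the set of maps $\mathcal S\to\mathbb C$, $D(\mathcal L)\subseteq M(\mathcal S)$ a linear subset and $\mathcal L:D(\mathcal L)\to M(\mathcal S)$ linear; fix a filtered probability space with right-continuous filtration. An $\mathcal S$-valued process $(\mathbb X_t)_{t\in[0,T]}$ solves the martingale problem for $\mathcal L$ if (1) $\mathbb X_0=\mathbf x$ for some initial value $\mathbf x\in\mathcal S$; (2) there is a version of $\mathbb X$ such that $(f(\mathbb X_t))_t$ and $(\mathcal Lf(\mathbb X_t))_t$ are adapted càdlàg processes for every $f\in D(\mathcal L)$; (3) $f(\mathbb X_t)-f(\mathbb X_0)-\int_0^t\mathcal Lf(\mathbb X_s)ds$ is a local martingale for every $f\in D(\mathcal L)$. Polynomial: let $\mathcal U\subseteq\mathcal S^*$ be a linear subset and $D(\mathcal L):=\{\mathbf x\mapsto\langle\mathbf u,\mathbf x\rangle:\mathbf u\in\mathcal U\}$. A linear operator $\mathcal L:D(\mathcal L)\to M(\mathcal S)$ is of $\mathcal U$-polynomial type if there is a map $L:\mathcal U\to\mathcal S^*$ with $\mathcal L(\langle\mathbf u,\cdot\rangle)(\mathbf x)=\langle L(\mathbf u),\mathbf x\rangle$ for all $\mathbf u\in\mathcal U$, $\mathbf x\in\mathcal S$. Any solution of the martingale problem for such an $\mathcal L$ is called an $\mathcal S$-valued $\mathcal U$-polynomial process. *)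

(* Defs.v *)
From HB Require Import structures.
From mathcomp Require Import all_boot all_order all_algebra.
From mathcomp Require Import complex.
From mathcomp Require Import all_classical all_reals all_analysis.
Import Order.TTheory GRing.Theory Num.Theory.
Import numFieldNormedType.Exports.

Set Implicit Arguments.
Unset Strict Implicit.
Unset Printing Implicit Defensive.

Local Open Scope classical_set_scope.
Local Open Scope ring_scope.
Local Open Scope complex_scope.

Section ExtendedTensorAlgebra.
Variables (R : realType) (d : nat).

(* A tensor in (R^d)^{(x) n} is given by its coefficients in the basis
   (e_I), |I| = n, so that a sequence (a_0, a_1, ...) of tensors is a function
   of the multi-index I, of length |I| = size I. *)
Definition multi_index := seq 'I_d.
Definition ext_tensor := multi_index -> R.
(* the complexification T((R^d)) + i T((R^d)) *)
Definition ext_tensorC := multi_index -> R[i]^o.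

Definition graded_partition (Pi : nat -> set multi_index) :=
  [/\ forall k, Pi k !=set0,
      trivIset setT Pi,
      \bigcup_k Pi k = setT
    & forall k I J, Pi k I -> Pi k J -> size I = size J].

(* <pi_n u, pi_n x>, bilinear: there is no complex conjugation *)
Definition level_pairing (n : nat) (u : ext_tensorC) (x : ext_tensor) : R[i]^o :=
  \sum_(I : n.-tuple 'I_d) u I * (x I)%:C.

Definition pairing (u : ext_tensorC) (x : ext_tensor) : R[i]^o :=
  limn (fun N => \sum_(0 <= n < N.+1) level_pairing n u x).

(* |u|_x; the blocks of a graded partition are finite, hence so are the inner
   sums *)
Definition seminorm (Pi : nat -> set multi_index)
    (u : ext_tensorC) (x : ext_tensor) : \bar R :=
  (\sum_(0 <= k <oo) (Normc.normc (\sum_(I \in Pi k) u I * (x I)%:C))%:E)%E.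

Definition dual_set (Pi : nat -> set multi_index) (S : set ext_tensor) :
    set ext_tensorC :=
  [set u | forall x, S x -> (seminorm Pi u x < +oo)%E].

Definition product_sigma_algebra : set_system ext_tensor :=
  <<s \bigcup_(I in [set: multi_index])
        preimage_set_system setT (fun x : ext_tensor => x I) measurable >>.

Definition trace_sigma_algebra (S : set ext_tensor) : set_system S :=
  preimage_set_system setT (fun x : S => \val x) product_sigma_algebra.

Definition evaluation (S : set ext_tensor) (u : ext_tensorC) : S -> R[i]^o :=
  fun x => pairing u (\val x).

End ExtendedTensorAlgebra.

Section ComplexValued.
Variable R : realType.

Definition cintegrable dO (O : measurableType dO)
    (mu : {measure set O -> \bar R}) (D : set O) (f : O -> R[i]) :=
  mu.-integrable D (fun x => (complex.Re (f x))%:E) /\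
  mu.-integrable D (fun x => (complex.Im (f x))%:E).

Definition cintegral dO (O : measurableType dO)
    (mu : {measure set O -> \bar R}) (D : set O) (f : O -> R[i]) : R[i] :=
  (\int[mu]_(x in D) complex.Re (f x)) +i* (\int[mu]_(x in D) complex.Im (f x)).

Definition linear_subset (V : lmodType R[i]) (A : set V) :=
  A 0 /\ forall (a : R[i]) v w, A v -> A w -> A (a *: v + w).

Definition linear_on (V W : lmodType R[i]) (A : set V) (f : V -> W) :=
  forall (a : R[i]) v w, A v -> A w -> f (a *: v + w) = a *: f v + f w.

End ComplexValued.

(* Processes on the time interval [0, T] are functions of a real time whose
   values outside [0, T] are irrelevant. *)
Section Processes.
Variables (R : realType) (dO : measure_display) (O : measurableType dO).
Variables (P : probability O R) (T : R).

Definition right_continuous_filtration (F : R -> set_system O) :=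
  [/\ forall t : R, 0 <= t <= T -> sigma_algebra setT (F t),
      forall t : R, 0 <= t <= T -> F t `<=` measurable,
      forall s t : R, 0 <= s -> s <= t -> t <= T -> F s `<=` F t
    & forall t : R, 0 <= t < T -> \bigcap_(s in `]t, T]) F s = F t].

Definition measurable_for (G : set_system O) (f : O -> R) :=
  forall B, measurable B -> G (f @^-1` B).

Definition adapted (F : R -> set_system O) (M : R -> O -> R) :=
  forall t : R, 0 <= t <= T -> measurable_for (F t) (M t).

Definition cadapted (F : R -> set_system O) (M : R -> O -> R[i]) :=
  adapted F (fun t w => complex.Re (M t w)) /\ adapted F (fun t w => complex.Im (M t w)).

Definition cadlag (V : topologicalType) (g : R -> V) :=
  (forall t : R, 0 <= t < T -> g s @[s --> t^'+] --> g t) /\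
  (forall t : R, 0 < t <= T -> exists l : V, g s @[s --> t^'-] --> l).

(* E[M_t | F_s] = M_s is expressed by the defining property of the
   conditional expectation. *)
Definition martingale (F : R -> set_system O) (M : R -> O -> R) :=
  [/\ adapted F M,
      forall t : R, 0 <= t <= T -> P.-integrable setT (fun w => (M t w)%:E)
    & forall (s t : R) A, 0 <= s -> s <= t -> t <= T -> F s A ->
        \int[P]_(w in A) M t w = \int[P]_(w in A) M s w].

Definition stopping_time (F : R -> set_system O) (tau : O -> R) :=
  (forall w, 0 <= tau w <= T) /\
  (forall t : R, 0 <= t <= T -> F t [set w | tau w <= t]).

(* On the compact time interval [0, T] a localizing sequence is almost surely
   nondecreasing and eventually equal to T. The processes localized below
   start at 0, so the initial value needs no separate treatment. *)
Definition local_martingale (F : R -> set_system O) (M : R -> O -> R) :=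
  [/\ adapted F M,
      forall w, cadlag (fun t => M t w)
    & exists tau : nat -> O -> R,
      [/\ forall n, stopping_time F (tau n),
          {ae P, forall w, (forall n, tau n w <= tau n.+1 w) /\
                           (\forall n \near \oo, tau n w = T)}
        & forall n, martingale F (fun t w => M (Num.min t (tau n w)) w)]].

Definition clocal_martingale (F : R -> set_system O) (M : R -> O -> R[i]) :=
  local_martingale F (fun t w => complex.Re (M t w)) /\
  local_martingale F (fun t w => complex.Im (M t w)).

End Processes.

Section PolynomialProcesses.
Variables (R : realType) (d : nat) (S : set (ext_tensor R d)).

(* M(S) is S -> R[i]^o, where S is viewed as a type; an operator is a map on
   M(S) of which only the values on its domain are relevant. *)

Definition linear_operator (DL : set (S -> R[i]^o))
    (Lop : (S -> R[i]^o) -> (S -> R[i]^o)) :=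
  linear_subset DL /\ linear_on DL Lop.

Definition polynomial_domain (U : set (ext_tensorC R d)) : set (S -> R[i]^o) :=
  [set evaluation u | u in U].

(* Lop is of U-polynomial type, with associated map L *)
Definition polynomial_type (Pi : nat -> set (multi_index d))
    (U : set (ext_tensorC R d)) (Lop : (S -> R[i]^o) -> (S -> R[i]^o))
    (L : ext_tensorC R d -> ext_tensorC R d) :=
  linear_operator (polynomial_domain U) Lop /\
  forall u, U u -> dual_set Pi S (L u) /\
    forall x : S, Lop (evaluation u) x = evaluation (L u) x.

Variables (dO : measure_display) (O : measurableType dO).
Variables (P : probability O R) (T : R).

Definition S_process (X : R -> O -> S) :=
  forall t : R, 0 <= t <= T ->
  forall A, trace_sigma_algebra A -> measurable (X t @^-1` A).

Definition version (X Y : R -> O -> S) :=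
  forall t : R, 0 <= t <= T -> {ae P, forall w, Y t w = X t w}.

Definition compensated (f g : S -> R[i]^o) (X : R -> O -> S) (t : R) (w : O)
    : R[i] :=
  f (X t w) - f (X 0 w)
  - cintegral lebesgue_measure `[0, t] (fun s => g (X s w)).

(* X itself need not have regular paths: the path integral and the local
   martingale are those of the version with cadlag paths. *)
Definition solves_martingale_problem (F : R -> set_system O)
    (DL : set (S -> R[i]^o)) (Lop : (S -> R[i]^o) -> (S -> R[i]^o))
    (X : R -> O -> S) (x0 : S) :=
  [/\ S_process X,
      {ae P, forall w, X 0 w = x0}
    & exists Y : R -> O -> S,
      [/\ S_process Y, version X Y,
          forall f, DL f ->
            [/\ cadapted T F (fun t w => f (Y t w)),
                forall w, cadlag T (fun t => f (Y t w)),
                cadapted T F (fun t w => Lop f (Y t w))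
              & forall w, cadlag T (fun t => Lop f (Y t w))]
        & forall f, DL f ->
            clocal_martingale P T F (compensated f (Lop f) Y)]].

Definition polynomial_process (F : R -> set_system O)
    (U : set (ext_tensorC R d)) (Lop : (S -> R[i]^o) -> (S -> R[i]^o))
    (X : R -> O -> S) (x0 : S) :=
  solves_martingale_problem F (polynomial_domain U) Lop X x0.

End PolynomialProcesses.

(* a U-valued solution on [0, T] of c(t) = u + int_0^t L(c(s)) ds, read
   coefficientwise *)
Definition linear_ode_solution (R : realType) (d : nat)
    (U : set (ext_tensorC R d)) (L : ext_tensorC R d -> ext_tensorC R d)
    (T : R) (u : ext_tensorC R d) (c : R -> ext_tensorC R d) :=
  [/\ forall t : R, 0 <= t <= T -> U (c t),
      forall I, cintegrable lebesgue_measure `[0, T] (fun s => L (c s) I)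
    & forall t : R, 0 <= t <= T -> forall I,
        c t I = u I + cintegral lebesgue_measure `[0, t] (fun s => L (c s) I)].

(* Main.v *)
Require Import Defs.
From HB Require Import structures.
From mathcomp Require Import all_boot all_order all_algebra.
From mathcomp Require Import complex lra measurable_realfun.
From mathcomp Require Import all_classical all_reals all_analysis.
Import Order.TTheory GRing.Theory Num.Theory.
Import numFieldNormedType.Exports.
Set Implicit Arguments.
Unset Strict Implicit.
Unset Printing Implicit Defensive.
Local Open Scope classical_set_scope.
Local Open Scope ring_scope.
Local Open Scope complex_scope.

(** The duality argument for polynomial processes.  Set
      G(s, t) = E<c(s), X_t>   and   h(s, t) = E<L(c(s)), X_t>.
    Two evolutions meet in G.  In the variable s, the coefficientwise ODE
    pairs with a state x to <c(s), x> = <u, x> + int_0^s <L(c(r)), x> dr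
    ([pairing_ode]; the exchange of the sum over the levels and the integral
    is dominated by the seminorm |L(c(r))|_x), so Fubini gives
      G(s, t) = G(0, t) + int_0^s h(r, t) dr.
    In the variable t, the martingale problem for the function <c(s), .>, whose
    image under the operator is <L(c(s)), .>, gives
      G(s, t) = G(s, 0) + int_0^t h(s, r) dr,
    because the local martingale is dominated through the two supremum
    hypotheses and hence has mean zero ([local_martingale_expectation]).
    Formally dG/ds = h = dG/dt, so G is a function of s + t, and
    E<u, X_T> = G(0, T) = G(T, 0) = <c(T), x0>.

    The function h is bounded and measurable but need not be continuous in s, so
    the formal step needs an argument ([diagonal_identity]).  Integrating h over the
    triangle s, t >= 0, s + t <= tau in the two orders, the contributions of G
    on the hypotenuse cancel, and int_0^tau (G(0, r) - G(r, 0)) dr = 0 is left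
    for every tau in [0, T].  Since G is Lipschitz, the integrand vanishes at T.

    The measure-theoretic care concerns the suprema.  They run over uncountably
    many pairs (s, t) and need not be measurable, and they are suprema for X,
    whereas only the version Y has regular paths.  For a fixed s, the supremum
    of X over countably many times is measurable and lies below the given one;
    it agrees almost surely with that of Y, where right continuity extends it to
    all times ([sup_domination]).  Right continuity also provides the joint
    measurability that Fubini requires ([measurable_right_continuous]).  The
    complex-valued statement splits into real and imaginary parts, to which one
    real argument applies. *)

(** * Fubini for real-valued iterated integrals *)

Section FubiniR.
Context d1 d2 (T1 : measurableType d1) (T2 : measurableType d2) (R : realType).

(** An integrable function is finite almost everywhere, so truncating its
    infinite values, as the real-valued integral does, changes nothing. *)
Lemma integrable_fine d (T : measurableType d) (m : {measure set T -> \bar R})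
    (F : T -> \bar R) : m.-integrable setT F ->
  m.-integrable setT (fun x => (fine (F x))%:E) /\
  (\int[m]_x (fine (F x))%:E = \int[m]_x F x)%E.
Proof.
move=> iF.
have mF : measurable_fun setT (fun x => (fine (F x))%:E).
  apply/measurable_EFinP.
  have : measurable_fun setT F by case/integrableP: iF.
  exact: measurableT_comp.
have ae : {ae m, forall x, setT x -> (fine (F x))%:E = F x}.
  have := integrable_ae measurableT iF.
  by apply: filterS => x /(_ Logic.I) + _ => /fineK <-.
split; last first.
  by apply: ae_eq_integral => //; case/integrableP: iF.
apply: (le_integrable measurableT mF _ iF) => x _ /=.
by case: (F x) => [r||] /=; rewrite ?leey.
Qed.

Variable m1 : {sigma_finite_measure set T1 -> \bar R}.
Variable m2 : {sigma_finite_measure set T2 -> \bar R}.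

Lemma Rintegral_fubini (f : T1 -> T2 -> R) :
  (m1 \x m2)%E.-integrable setT (fun z => (f z.1 z.2)%:E) ->
  [/\ m1.-integrable setT (fun x => (\int[m2]_y f x y)%:E),
      m2.-integrable setT (fun y => (\int[m1]_x f x y)%:E) &
  \int[m1]_x \int[m2]_y f x y = \int[m2]_y \int[m1]_x f x y].
Proof.
move=> intf.
have [i1 e1] := integrable_fine (integrable_fubini_F intf).
have iG : m2.-integrable setT (fubini_G m1 (fun z => (f z.1 z.2)%:E)).
  have mf : measurable_fun setT (fun z : T1 * T2 => (f z.1 z.2)%:E).
    by case/integrableP: intf.
  have lty := (integrable21ltyP m1 m2 mf).1 intf.
  apply/integrableP; split; first exact: measurable_fubini_G intf.
  apply: le_lt_trans lty; apply: ge0_le_integral => //.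
  - exact/measurableT_comp/(measurable_fubini_G intf).
  - apply: (@measurable_fun_fubini_tonelli_G _ _ T1 T2 R m1
      (fun z => `|(f z.1 z.2)%:E|%E)) => //.
    exact: measurableT_comp.
  - move=> y _; apply: le_abse_integral => //.
    apply: measurableT_comp mf _; exact: measurable_pair2.
have [i2 e2] := integrable_fine iG.
split => //; rewrite /Rintegral; congr fine.
by rewrite [LHS]e1 [RHS]e2 integral12_prod_meas1// integral21_prod_meas1.
Qed.

End FubiniR.

(** * Functions with the same partial derivatives in both variables *)

Section Diagonal.
Variable R : realType.
Notation mu := (@lebesgue_measure R).

(** Composing with the projection onto [0, T] makes functions that are
    controlled on [0, T] only behave on the whole line. *)
Definition clamp (T r : R) : R := Num.max 0 (Num.min r T).

Lemma clamp_itv (T r : R) : 0 <= T -> 0 <= clamp T r <= T.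
Proof. by move=> T0; rewrite /clamp le_max lexx ge_max T0 ge_min lexx orbT. Qed.

Lemma clamp_id (T r : R) : 0 <= r <= T -> clamp T r = r.
Proof. by move=> /andP[r0 rT]; rewrite /clamp min_l// max_r. Qed.

Lemma clamp_lipschitz (T r s : R) : `|clamp T r - clamp T s| <= `|r - s|.
Proof.
rewrite /clamp /Num.max /Num.min.
have := ler_norm (r - s); have := ler_norm (s - r); rewrite (distrC s r).
move=> h1 h2; rewrite ler_norml.
case: (ltP r T) => ?; case: (ltP s T) => ?;
  repeat case: ifPn; rewrite -?leNgt => *; apply/andP; split; lra.
Qed.

Lemma Rintegral_itv_bound (f : R -> R) (K a b : R) : a <= b ->
  measurable_fun setT f -> (forall r, `|f r| <= K) ->
  mu.-integrable `[a, b] (EFin \o f) /\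
  `|\int[mu]_(r in `]a, b]) f r| <= K * (b - a).
Proof.
move=> ab mf fK.
have i1 : mu.-integrable `[a, b] (EFin \o f).
  apply: measurable_bounded_integrable => //=.
  - by rewrite lebesgue_measure_itv /=; case: ifP => // _; rewrite -EFinB ltry.
  - exact: measurable_funS mf.
  - exists K; split; first exact: num_real.
    by move=> M KM r _ /=; rewrite (le_trans (fK r))// ltW.
split=> //.
have i2 : mu.-integrable `]a, b] (EFin \o f).
  by apply: integrableS i1 => //; apply: subset_itvr; rewrite bnd_simp.
apply: le_trans (le_normr_Rintegral _ i2) _ => //.
have ic : mu.-integrable `]a, b] (EFin \o cst K).
  apply: measurable_bounded_integrable => //=.
  - by rewrite lebesgue_measure_itv /=; case: ifP => // _; rewrite -EFinB ltry.
  - by exists `|K|; split; [exact: num_real|move=> M KM r _ /=; rewrite ltW].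
apply: (@le_trans _ _ (\int[mu]_(r in `]a, b]) K)).
  apply: le_Rintegral => //; exact: integrable_norm i2.
rewrite Rintegral_cst//= lebesgue_measure_itv /= lte_fin.
by case: ltP => //= ba; rewrite mulr0 mulr_ge0// ?subr_ge0// (le_trans _ (fK 0)).
Qed.

Lemma Rintegral_itv_lipschitz (f : R -> R) (K s t : R) :
  measurable_fun setT f -> (forall r, `|f r| <= K) -> 0 <= s -> 0 <= t ->
  `|\int[mu]_(r in `[0, s]) f r - \int[mu]_(r in `[0, t]) f r| <= K * `|s - t|.
Proof.
move=> mf fK; wlog st : s t / t <= s => [hw s0 t0|s0 t0].
  have [/hw|/ltW/hw] := leP t s; first exact.
  by rewrite distrC [X in _ <= _ * X]distrC; exact.
have [i1 _] := Rintegral_itv_bound s0 mf fK.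
rewrite Rintegral_itvB ?bnd_simp// (@ger0_norm _ (s - t)) ?subr_ge0//.
exact: (Rintegral_itv_bound st mf fK).2.
Qed.

Lemma Rintegral_reflect (g : R -> R) (tau : R) : 0 <= tau -> continuous g ->
  \int[mu]_(t in `[0, tau]) g (tau - t) = \int[mu]_(s in `[0, tau]) g s.
Proof.
move=> tau0 cg; rewrite /Rintegral; congr fine.
pose F x : R := tau - x.
have dF : derive1 F = cst (-1).
  by apply/funext => x; rewrite /F derive1E derive_val add0r mul1r.
have cF : continuous F by move=> x; apply: cvgB; [exact: cvg_cst|exact: cvg_id].
have := @integration_by_substitution_decreasing R F g 0 tau tau0.
rewrite /F subrr subr0 -/F dF => -> //.
- by apply: eq_integral => x _; rewrite /= opprK mulr1.
- by move=> x y _ _ xy; rewrite ltrD2l ltrN2.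
- by move=> x _; exact: cvg_cst.
- exact: is_cvg_cst.
- exact: is_cvg_cst.
- split=> [x _||]; first exact: derivableB.
  + by apply: cvg_at_right_filter; exact: cF.
  + by apply: cvg_at_left_filter; exact: cF.
- exact: continuous_subspaceT.
Qed.

Definition triangle (tau : R) : set (R * R) :=
  [set z | [&& 0 <= z.1, 0 <= z.2 & z.1 + z.2 <= tau]].

Lemma measurable_triangle tau : measurable (triangle tau).
Proof.
rewrite (_ : triangle tau = (fst @^-1` `[0, +oo[) `&` (snd @^-1` `[0, +oo[) `&`
   ((fun z => z.1 + z.2) @^-1` `]-oo, tau])); last first.
  apply/seteqP; split => z /=; rewrite /triangle /= !in_itv/= ?andbT.
    by move=> /and3P[].
  by move=> [[-> ->] ->].
apply: measurableI; first apply: measurableI.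
- by rewrite -[X in measurable X]setTI; apply: measurable_fst.
- by rewrite -[X in measurable X]setTI; apply: measurable_snd.
- rewrite -[X in measurable X]setTI.
  by apply: (measurable_funD measurable_fst measurable_snd).
Qed.

(** Both sides are the integral of [h] over the triangle, which has finite
    measure because it lies in a square. *)
Lemma Rintegral_fubini_triangle (h : R -> R -> R) (K tau : R) : 0 <= tau ->
  measurable_fun setT (fun z : R * R => h z.1 z.2) ->
  (forall s t, `|h s t| <= K) ->
  \int[mu]_(t in `[0, tau]) \int[mu]_(s in `[0, tau - t]) h s t =
  \int[mu]_(s in `[0, tau]) \int[mu]_(t in `[0, tau - s]) h s t.
Proof.
move=> tau0 mh hK.
pose f s t := ((fun z => h z.1 z.2) \_ (triangle tau)) (s, t).
have itau : (mu \x mu)%E.-integrable setT (fun z : R * R => (f z.1 z.2)%:E).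
  have : (mu \x mu)%E.-integrable (triangle tau) (EFin \o (fun z => h z.1 z.2)).
    apply: measurable_bounded_integrable.
    - exact: measurable_triangle.
    - apply: (@le_lt_trans _ _ ((mu \x mu)%E (`[0, tau] `*` `[0, tau]))).
        apply: le_measure; rewrite ?inE; first exact: measurable_triangle.
          exact: measurableX.
        move=> [s t] /and3P[/= s0 t0 st]; split; rewrite /= in_itv/=; lra.
      rewrite product_measure1E//.
      have mt : (mu `[0%R, tau]%classic < +oo)%E.
        by rewrite lebesgue_measure_itv /=; case: ifP => // _; rewrite -EFinB ltry.
      by rewrite lte_mul_pinfty// ge0_fin_numE.
    - exact: measurable_funS mh.
    - exists K; split; first exact: num_real.
      by move=> M KM r _ /=; rewrite (le_trans (hK _ _))// ltW.
  move/integrable_mkcond => /(_ (measurable_triangle tau)).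
  by apply: eq_integrable => // -[s t] _; rewrite /f /= restrict_EFin.
have [_ _ e] := Rintegral_fubini itau.
rewrite [LHS]Rintegral_mkcond [RHS]Rintegral_mkcond.
transitivity (\int[mu]_t \int[mu]_s f s t); last first.
  rewrite -e; apply: eq_Rintegral => s _.
  rewrite patchE; case: ifPn => sin.
    rewrite [RHS]Rintegral_mkcond; apply: eq_Rintegral => t _.
    move: sin; rewrite /f !patchE inE/= in_itv /= => /andP[s0 st].
    congr (if _ then _ else _); apply/idP/idP; rewrite !inE /triangle /= in_itv/=;
      rewrite s0 /=; lra.
  rewrite /Rintegral integral0_eq// => t _; rewrite /f patchE ifN//.
  apply: contra sin; rewrite !inE /triangle /= in_itv /=; lra.
apply: eq_Rintegral => s _.
rewrite patchE; case: ifPn => sin.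
  rewrite [LHS]Rintegral_mkcond; apply: eq_Rintegral => t _.
  move: sin; rewrite /f !patchE inE/= in_itv /= => /andP[s0 st].
  congr (if _ then _ else _); apply/idP/idP; rewrite !inE /triangle /= in_itv/=;
    rewrite s0 /=; lra.
rewrite /Rintegral integral0_eq// => t _; rewrite /f patchE ifN//.
apply: contra sin; rewrite !inE /triangle /= in_itv /=; lra.
Qed.

Lemma lipschitz_continuous (g : R -> R) (K : R) : 
  (forall s t, `|g s - g t| <= K * `|s - t|) -> continuous g.
Proof.
move=> gK t; apply/cvgrPdist_lt => e e0.
have K0 : 0 <= K by have := gK 1 0; rewrite subr0 normr1 mulr1; exact: le_trans.
have K1 : 0 < K + 1 by rewrite ltr_wpDl.
near=> s; apply: le_lt_trans (gK _ _) _.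
apply: (@le_lt_trans _ _ ((K + 1) * `|t - s|)); first by rewrite ler_wpM2r// lerDl.
rewrite -ltr_pdivlMl//; near: s.
have d0 : 0 < (K + 1)^-1 * e by rewrite mulr_gt0// invr_gt0.
by have := nbhsx_ballx t _ d0; apply: filterS => s.
Unshelve. all: by end_near. Qed.

(** Otherwise [k] would keep the sign of [k T], and half its size, on an interval
    that ends at [T]; but the integral over this interval is a difference of two
    vanishing primitives. *)
Lemma lipschitz_primitive_eq0 (k : R -> R) (K T : R) : 0 < T ->
  (forall s t, `|k s - k t| <= K * `|s - t|) ->
  (forall tau, 0 <= tau <= T -> \int[mu]_(r in `[0, tau]) k r = 0) ->
  k T = 0.
Proof.
move=> T0; have icont (g : R -> R) a b :
    continuous g -> mu.-integrable `[a, b] (EFin \o g).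
  move=> cg; apply: continuous_compact_integrable; first exact: segment_compact.
  exact: continuous_subspaceT.
suff le0 (g : R -> R) : (forall s t, `|g s - g t| <= K * `|s - t|) ->
    (forall tau, 0 <= tau <= T -> \int[mu]_(r in `[0, tau]) g r = 0) -> g T <= 0.
  move=> kL k0; apply/eqP; rewrite eq_le le0//= -oppr_le0.
  apply: (le0 (fun r => - k r)) => [s t|tau tauT].
    by rewrite -opprD normrN.
  have ck := lipschitz_continuous kL.
  under eq_Rintegral do rewrite -mulN1r.
  by rewrite (RintegralZl _ _ (icont _ 0 tau ck))// k0// mulr0.
move=> gL g0; rewrite leNgt; apply/negP => gT.
have K0 : 0 <= K by have := gL 1 0; rewrite subr0 normr1 mulr1; exact: le_trans.
(* short enough for the oscillation K * e of g to stay below g T / 2 *)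
pose e := Num.min T (g T / (K + 1) / 2).
have e0 : 0 < e by rewrite lt_min T0 !divr_gt0// ltr_wpDl.
have eT : e <= T by rewrite ge_min lexx.
have eg : (K + 1) * e <= g T / 2.
  rewrite mulrC -ler_pdivlMr ?ltr_wpDl//.
  by rewrite mulrAC /e ge_min lexx orbT.
have cg := lipschitz_continuous gL.
have sub : `]T - e, T]%classic `<=` `[T - e, T]%classic.
  by apply: subset_itvr; rewrite bnd_simp.
have : \int[mu]_(r in `]T - e, T]) g r = 0.
  rewrite -(Rintegral_itvB (icont _ 0 T cg)) ?bnd_simp ?subr_ge0// ?gerBl ?ltW//.
  by rewrite (g0 T) ?(g0 (T - e)) ?subrr//; apply/andP; split; lra.
have ig : mu.-integrable `]T - e, T] (EFin \o g).
  exact: integrableS (icont _ (T - e) T cg).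
have icst (x : R) : mu.-integrable `]T - e, T] (EFin \o cst x).
  apply: integrableS (icont _ (T - e) T _) => //.
  by move=> ?; exact: cvg_cst.
have intc (x : R) : \int[mu]_(r in `]T - e, T]) x = x * e.
  rewrite Rintegral_cst//= lebesgue_measure_itv /= lte_fin gtrBl e0 /=.
  by rewrite opprB addrC subrK.
have le r : `]T - e, T]%classic r -> g T / 2 <= g r.
  rewrite /= in_itv/= => /andP[r1 r2].
  have : `|g r - g T| <= g T / 2.
    apply: le_trans (gL _ _) _; apply: le_trans _ eg.
    have re : `|r - T| <= e by rewrite ler_norml; apply/andP; split; lra.
    by apply: ler_pM => //; rewrite lerDl.
  by rewrite ler_norml => /andP[]; lra.
have := @le_Rintegral _ _ _ mu _ (cst (g T / 2)) g (measurable_itv _) (icst _) ig le.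
by rewrite intc => /[swap] ->; rewrite leNgt mulr_gt0// divr_gt0.
Qed.

(** Formally [h] is both partial derivatives of [G], which is then constant
    along the antidiagonals; see the introduction for the role of the
    triangles. *)
Lemma diagonal_identity (T K : R) (G h : R -> R -> R) : 0 < T ->
  measurable_fun setT (fun z : R * R => h z.1 z.2) ->
  (forall s t, `|h s t| <= K) ->
  (forall s t, 0 <= s <= T -> 0 <= t <= T ->
    G s t = G 0 t + \int[mu]_(r in `[0, s]) h r t) ->
  (forall s t, 0 <= s <= T -> 0 <= t <= T ->
    G s t = G s 0 + \int[mu]_(r in `[0, t]) h s r) ->
  G 0 T = G T 0.
Proof.
move=> T0 mh hK G1 G2.
have K0 : 0 <= K by exact: le_trans (hK 0 0).
(* globally Lipschitz, hence continuous and integrable on segments *)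
pose H s t := G (clamp T s) (clamp T t).
have HG s t : 0 <= s <= T -> 0 <= t <= T -> H s t = G s t.
  by move=> ? ?; rewrite /H !clamp_id.
have cT r : 0 <= clamp T r <= T by exact: clamp_itv (ltW T0).
have mh1 t : measurable_fun setT (h ^~ t).
  exact: (measurableT_comp mh (measurable_pair2 t)).
have mh2 s : measurable_fun setT (h s).
  exact: (measurableT_comp mh (measurable_pair1 s)).
have L1 s s' t : `|H s t - H s' t| <= K * `|s - s'|.
  rewrite /H G1// (G1 (clamp T s'))// opprD addrACA subrr add0r.
  apply: le_trans (@Rintegral_itv_lipschitz _ K _ _ _ _ _ _) _ => //.
  - by case/andP: (cT s).
  - by case/andP: (cT s').
  - by rewrite ler_wpM2l// clamp_lipschitz.
have L2 s t t' : `|H s t - H s t'| <= K * `|t - t'|.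
  rewrite /H G2// (G2 _ (clamp T t'))// opprD addrACA subrr add0r.
  apply: le_trans (@Rintegral_itv_lipschitz _ K _ _ _ _ _ _) _ => //.
  - by case/andP: (cT t).
  - by case/andP: (cT t').
  - by rewrite ler_wpM2l// clamp_lipschitz.
have icont (g : R -> R) a b : continuous g -> mu.-integrable `[a, b] (EFin \o g).
  move=> cg; apply: continuous_compact_integrable; first exact: segment_compact.
  exact: continuous_subspaceT.
pose k tau := H 0 tau - H tau 0.
have c1 : continuous (H 0) by apply: (@lipschitz_continuous _ K) => s t; exact: L2.
have c2 : continuous (H ^~ 0) by apply: (@lipschitz_continuous _ K) => s t; exact: L1.
have kL s t : `|k s - k t| <= (2 * K) * `|s - t|.
  rewrite /k opprD addrACA opprK (le_trans (ler_normD _ _))//.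
  by rewrite -mulrA mulr_natl mulr2n lerD// ?L2// addrC distrC L1.
have k0 tau : 0 <= tau <= T -> \int[mu]_(r in `[0, tau]) k r = 0.
  move=> /andP[tau0 tauT].
  have cd : continuous (fun s => H s (tau - s)).
    apply: (@lipschitz_continuous _ (2 * K)) => s t.
    rewrite (le_trans (ler_distD (H t (tau - s)) _ _))//.
    rewrite -mulrA mulr_natl mulr2n lerD// ?L1// (le_trans (L2 _ _ _))//.
    by rewrite opprD addrACA subrr add0r opprK addrC distrC.
  have cd' : continuous (fun s => H (tau - s) s).
    apply: (@lipschitz_continuous _ (2 * K)) => s t.
    rewrite (le_trans (ler_distD (H (tau - t) s) _ _))//.
    rewrite -mulrA mulr_natl mulr2n lerD// ?L2// (le_trans (L1 _ _ _))//.
    by rewrite opprD addrACA subrr add0r opprK addrC distrC.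
  have := Rintegral_fubini_triangle tau0 mh hK.
  have inT t : 0 <= t -> t <= tau -> (0 <= t <= T) * (0 <= tau - t <= T).
    by move=> ? ?; split; apply/andP; split; lra.
  have in0 : (0 : R) <= 0 <= T by rewrite lexx ltW.
  have -> : \int[mu]_(t in `[0, tau]) \int[mu]_(s in `[0, tau - t]) h s t =
      \int[mu]_(t in `[0, tau]) H (tau - t) t - \int[mu]_(t in `[0, tau]) H 0 t.
    rewrite -RintegralB//; [|exact: icont..].
    apply: eq_Rintegral => t; rewrite inE/= in_itv/= => /andP[t0 tt].
    have [i1 i2] := inT _ t0 tt.
    by rewrite !HG// (G1 (tau - t))// [RHS]addrC addKr.
  have -> : \int[mu]_(s in `[0, tau]) \int[mu]_(t in `[0, tau - s]) h s t =
      \int[mu]_(s in `[0, tau]) H s (tau - s) - \int[mu]_(s in `[0, tau]) H s 0.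
    rewrite -RintegralB//; [|exact: icont..].
    apply: eq_Rintegral => t; rewrite inE/= in_itv/= => /andP[t0 tt].
    have [i1 i2] := inT _ t0 tt.
    by rewrite !HG// (G2 t (tau - t))// [RHS]addrC addKr.
  (* the two hypotenuse terms differ by the reflection s = tau - t *)
  rewrite -(Rintegral_reflect tau0 cd).
  under [X in _ = X - _]eq_Rintegral do rewrite subKr.
  rewrite /k RintegralB//; [|exact: icont..].
  by move=> /addrI /oppr_inj ->; rewrite subrr.
suff : k T = 0.
  by rewrite /k !HG ?lexx ?ltW// => /eqP; rewrite subr_eq0 => /eqP.
exact: lipschitz_primitive_eq0 T0 kL k0.
Qed.

End Diagonal.

(** * Right-continuous families *)

Section RightContinuous.
Variable R : realType.

(** The first point strictly after [t] of the grid of mesh 1/(n+1): taken from the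
    right, from a countable set, and a step function of [t]. *)
Definition grid (n : nat) (t : R) : R :=
  (Num.floor (n.+1%:R * t) + 1)%:~R / n.+1%:R.

Lemma grid_gt n t : t < grid n t.
Proof. by rewrite /grid ltr_pdivlMr// mulrC floorD1_gt. Qed.

Lemma grid_le n t : grid n t <= t + n.+1%:R^-1.
Proof.
rewrite /grid ler_pdivrMr// mulrDl mulVf// mulrC intrD lerD2r.
exact: floor_le.
Qed.

Lemma cvg_grid t : grid n t @[n --> \oo] --> t.
Proof.
apply: (@squeeze_cvgr _ _ _ _ (cst t) (fun n => t + n.+1%:R^-1)).
- by near=> n; rewrite /= ltW ?grid_gt//= grid_le.
- exact: cvg_cst.
- rewrite -[X in _ --> X]addr0; apply: cvgD; first exact: cvg_cst.
  exact: cvg_harmonic.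
Unshelve. all: by end_near. Qed.

Lemma right_cvg_grid (g : R -> R) t :
  g r @[r --> t^'+] --> g t -> g (grid n t) @[n --> \oo] --> g t.
Proof.
move=> /cvg_at_rightP; apply; split; last exact: cvg_grid.
by move=> n; exact: grid_gt.
Qed.

Lemma clamp_right_continuous (T : R) (g : R -> R) : 0 < T ->
  (forall t, 0 <= t < T -> g r @[r --> t^'+] --> g t) ->
  forall t, g (clamp T r) @[r --> t^'+] --> g (clamp T t).
Proof.
move=> T0 gr t; have [tT|Tt] := ltP t T; last first.
  apply: cvg_near_cst; near=> r.
  have tr : t < r by near: r; exact: nbhs_right_gt.
  rewrite /clamp !min_r//; lra.
have [t0|t0] := leP 0 t.
  rewrite clamp_id ?t0 ?ltW//; have {}gr := gr t; rewrite t0 tT in gr.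
  apply: cvg_trans (gr isT); apply: near_eq_cvg; near=> r.
  have tr : t < r by near: r; exact: nbhs_right_gt.
  have rT : r < T by near: r; exact: nbhs_right_lt.
  by rewrite clamp_id//; apply/andP; split; lra.
apply: cvg_near_cst; near=> r.
have r0 : r < 0 by near: r; exact: nbhs_right_lt.
have tr : t < r by near: r; exact: nbhs_right_gt.
rewrite /clamp !min_l ?max_l//; lra.
Unshelve. all: by end_near. Qed.

(** [f] is the limit of [f (grid n t) x], and each of these is measurable because
    [grid n] takes countably many values, each of them on an interval. *)
Lemma measurable_right_continuous d (X : measurableType d) (f : R -> X -> R) :
  (forall x t, f r x @[r --> t^'+] --> f t x) ->
  (forall t, measurable_fun setT (f t)) ->
  measurable_fun setT (fun z : R * X => f z.1 z.2).
Proof.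
move=> fr mf; apply: (@measurable_fun_cvg _ _ _ _ (fun n z => f (grid n z.1) z.2));
  last by move=> [t x] _ /=; exact: (right_cvg_grid (g := f^~ x)).
move=> n _ B mB; rewrite setTI.
pose q (k : int) : R := (k + 1)%:~R / n.+1%:R.
pose E (k : int) : set (R * X) :=
  [set t | k%:~R <= n.+1%:R * t < (k + 1)%:~R] `*` (f (q k) @^-1` B).
rewrite (_ : _ @^-1` _ = \bigcup_(j in [set: nat])
  (if unpickle j is Some k then E k else set0)); last first.
  apply/seteqP; split => [[t x] /= fB|[t x] [j _]].
    exists (pickle (Num.floor (n.+1%:R * t))) => //; rewrite pickleK; split => //=.
    exact: floor_itv.
  case: unpickle => // k [/= tk].
  by rewrite /grid (floor_def tk).
apply: bigcup_measurable => j _; case: unpickle => // k.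
apply: measurableX; last by rewrite -[X in measurable X]setTI; exact: mf.
rewrite (_ : mkset _ = `[k%:~R / n.+1%:R, (k + 1)%:~R / n.+1%:R[%classic)//.
by apply/seteqP; split => t /=; rewrite in_itv/= ler_pdivrMr// ltr_pdivlMr// mulrC.
Qed.

End RightContinuous.

(** * Domination by a supremum that need not be measurable *)

Section Domination.
Variables (R : realType) (dO : measure_display) (O : measurableType dO).
Variables (P : probability O R) (T : R).

(** The integral of a nonnegative function is the supremum of the integrals of the
    simple functions below it, which is monotone even where neither function is
    measurable. *)
Lemma ge0_le_integral_nonmeasurable d (X : measurableType d)
    (m : {measure set X -> \bar R}) (f g : X -> \bar R) :
  (forall w, 0 <= f w)%E ->
  (forall w, f w <= g w)%E -> (\int[m]_w f w <= \int[m]_w g w)%E.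
Proof.
move=> f0 fg; have g0 w : (0 <= g w)%E by exact: le_trans (fg w).
rewrite !ge0_integralTE//; apply: le_ereal_sup => _ [h hf <-].
by exists h => // w; exact: le_trans (hf w) (fg w).
Qed.

(** An enumeration of the values of all [grid n]. *)
Definition grid_point (j : nat) : R :=
  if unpickle j is Some (k, m) then (k : int)%:~R / (m : nat).+1%:R else 0.

(** [g] has regular paths, [g'] is the process that [B] dominates. The dominating
    function is the supremum of |g'| over the countable set of grid points; it
    bounds |g| at these times outside one null set, and then at all times by right
    continuity. *)
Lemma sup_domination (g g' : R -> O -> R) (B : O -> \bar R) : 0 < T ->
  (forall w t, 0 <= t < T -> g r w @[r --> t^'+] --> g t w) ->
  (forall t, 0 <= t <= T -> measurable_fun setT (g' t)) ->
  (forall t, 0 <= t <= T -> {ae P, forall w, g t w = g' t w}) ->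
  (forall t w, 0 <= t <= T -> (`|g' t w|%:E <= B w)%E) ->
  (\int[P]_w B w < +oo)%E ->
  exists D : O -> \bar R, [/\ P.-integrable setT D,
    (\int[P]_w D w <= \int[P]_w B w)%E
    & {ae P, forall w t, 0 <= t <= T -> (`|g t w|%:E <= D w)%E}].
Proof.
move=> T0 gr mg' ver g'B BT.
pose q j := clamp T (grid_point j).
have qT j : 0 <= q j <= T by exact: clamp_itv (ltW T0).
pose D w := esups (fun j => `|g' (q j) w|%:E) 0%N.
have le_D w j : (`|g' (q j) w|%:E <= D w)%E.
  by apply: ereal_sup_ubound; exists j.
have D0 w : (0 <= D w)%E by apply: le_trans (le_D w 0%N); rewrite lee_fin.
have DB w : (D w <= B w)%E.
  by apply: ge_ereal_sup => _ [j _ <-]; exact: g'B.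
have mD : measurable_fun setT D.
  apply: measurable_fun_esups => j; apply/measurable_EFinP.
  by apply: measurableT_comp => //; exact: mg'.
have iDB : (\int[P]_w D w <= \int[P]_w B w)%E by exact: ge0_le_integral_nonmeasurable.
exists D; split => //.
  apply/integrableP; split => //.
  under eq_integral do rewrite gee0_abs//.
  exact: le_lt_trans BT.
have : {ae P, forall w, forall j, g (q j) w = g' (q j) w}.
  by apply: ae_foralln => j; exact: ver.
apply: filterS => w gq t tT.
have := @right_cvg_grid R (fun r => g (clamp T r) w) t.
rewrite clamp_id// => /(_ _)/cvg_norm h.
have {}h : `|g (clamp T (grid n t)) w| @[n --> \oo] --> `|g t w|.
  apply: h; have := @clamp_right_continuous R T (g^~ w) T0 (gr w) t.
  by rewrite clamp_id.
have gD n : (`|g (clamp T (grid n t)) w|%:E <= D w)%E.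
  have -> : grid n t = grid_point (pickle (Num.floor (n.+1%:R * t) + 1 : int, n)).
    by rewrite /grid_point pickleK.
  by rewrite gq.
case DE : (D w) => [r| |]; [|exact: leey|by have := D0 w; rewrite DE].
rewrite lee_fin; apply: (cvgr_to_le h); near=> n.
by rewrite -lee_fin -DE.
Unshelve. all: by end_near. Qed.

End Domination.

(** * Expectations of local martingales and of time integrals *)

Section LocalMartingale.
Variables (R : realType) (dO : measure_display) (O : measurableType dO).
Variables (P : probability O R) (T : R).

Lemma adapted_measurable (F : R -> set_system O) (M : R -> O -> R) :
  right_continuous_filtration T F -> adapted T F M ->
  forall t, 0 <= t <= T -> measurable_fun setT (M t).
Proof.
move=> [_ Fm _ _] aM t tT _ B mB; rewrite setTI.
by apply: (Fm t tT); exact: aM.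
Qed.

(** A path is eventually unaffected by the localizing sequence, so the stopped
    variables, of mean zero, converge to [M t] under the bound [D]. *)
Lemma local_martingale_expectation (F : R -> set_system O) (M : R -> O -> R)
    (D : O -> \bar R) : 0 < T ->
  right_continuous_filtration T F -> local_martingale P T F M ->
  (forall w, M 0 w = 0) ->
  P.-integrable setT D ->
  {ae P, forall w t, 0 <= t <= T -> (`|M t w|%:E <= D w)%E} ->
  forall t, 0 <= t <= T -> \int[P]_w M t w = 0.
Proof.
move=> T0 hF [aM cM [tau [stau tau_cvg mtau]]] M0 iD MD t tT.
have [t0 t1] := andP tT.
have tauT n w : 0 <= tau n w <= T by have [] := stau n.
have minT n w : 0 <= Num.min t (tau n w) <= T.
  by have /andP[? ?] := tauT n w; rewrite le_min ge_min t0 t1 /= andbT.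
have mean0 n : (\int[P]_w (M (Num.min t (tau n w)) w)%:E)%E = 0%E.
  have [_ iM mart] := mtau n; have [Fs _ _ _] := hF.
  have T00 : 0 <= (0 : R) <= T by rewrite lexx ltW.
  have F0T : F 0 setT.
    by have [h0 hD _] := Fs 0 T00; have := hD _ h0; rewrite setD0.
  have := mart 0 t setT (lexx _) t0 t1 F0T.
  rewrite [RHS](_ : _ = 0); last first.
    rewrite /Rintegral integral0_eq// => w _.
    by rewrite min_l ?M0//; case/andP: (tauT n w).
  move=> h; rewrite -[LHS]fineK; first by rewrite -[fine _]/(Rintegral _ _ _) h.
  by apply: integrable_fin_num => //; exact: iM.
have mM := adapted_measurable hF aM tT.
have [] := @dominated_convergence _ _ _ P setT measurableT
   (fun n w => (M (Num.min t (tau n w)) w)%:E) (fun w => (M t w)%:E) D.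
- by move=> n; have [_ iM _] := mtau n; case/integrableP: (iM t tT).
- exact/measurable_EFinP.
- apply: filterS tau_cvg => w [_ tw] _; apply: cvg_near_cst.
  by apply: filterS tw => n ->; rewrite min_l.
- exact: iD.
- by apply: filterS MD => w MDw n _; exact: MDw.
move=> iM _ ; rewrite (_ : [sequence _]_n = cst 0%E); last first.
  by apply/funext => n /=; rewrite mean0.
move=> /cvg_lim; rewrite lim_cst// => e0.
by rewrite /Rintegral -e0.
Qed.

End LocalMartingale.

Section ExpectationItv.
Variables (R : realType) (dO : measure_display) (O : measurableType dO).
Variables (P : probability O R).
Notation mu := (@lebesgue_measure R).

Lemma expectation_Rintegral_itv (b : R -> O -> R) (K t : R) :
  measurable_fun setT (fun z : R * O => b z.1 z.2) ->
  (forall r, 0 <= r <= t -> (\int[P]_w `|b r w|%:E <= K%:E)%E) ->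
  [/\ mu.-integrable `[0, t] (fun r => (\int[P]_w b r w)%:E),
      P.-integrable setT (fun w => (\int[mu]_(r in `[0, t]) b r w)%:E) &
  \int[P]_w \int[mu]_(r in `[0, t]) b r w =
  \int[mu]_(r in `[0, t]) \int[P]_w b r w].
Proof.
move=> mb bK.
pose f r w := ((fun z => b z.1 z.2) \_ (`[0, t] `*` setT)) (r, w).
have mD : measurable (`[0, t]%classic `*` [set: O] : set (R * O)).
  exact: measurableX.
have fE r w : f r w = if r \in `[0, t]%classic then b r w else 0.
  by rewrite /f patchE in_setX /= in_setT andbT.
have mf : measurable_fun setT (fun z : R * O => f z.1 z.2).
  rewrite (_ : (fun z => _) = (fun z => b z.1 z.2) \_ (`[0, t] `*` setT)).
    by apply/(measurable_restrictT _ mD); exact: measurable_funS mb.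
  by apply/funext => -[].
have intf : (mu \x P)%E.-integrable setT (fun z : R * O => (f z.1 z.2)%:E).
  apply/integrable12ltyP; first exact/measurable_EFinP.
  apply: (@le_lt_trans _ _ (\int[mu]_r ((cst (maxe K%:E 0)) \_ `[0%R, t]) r)%E).
    (* K itself may be negative when the interval is empty *)
    apply: ge0_le_integral_nonmeasurable => r.
      exact: integral_ge0.
    rewrite /= patchE; case: ifPn => rt.
      rewrite le_max; apply/orP; left; apply: le_trans (bK r _); last first.
        by rewrite inE/= in_itv/= in rt.
      by under eq_integral do rewrite fE rt.
    by rewrite integral0_eq// => w _; rewrite fE (negbTE rt) /= normr0.
  rewrite -integral_mkcond integral_cst//= lebesgue_measure_itv /=.
  case: ifP => _; last by rewrite mule0 ltry.
  by rewrite -EFinB /maxe; case: ifP; rewrite -?EFinM ?mul0e ltry.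
have [i1 i2 e] := Rintegral_fubini intf.
have e2 w : \int[mu]_r f r w = \int[mu]_(r in `[0, t]) b r w.
  rewrite [RHS]Rintegral_mkcond; apply: eq_Rintegral => r _.
  by rewrite fE patchE.
have e1 r : \int[P]_w f r w = ((fun r => \int[P]_w b r w) \_ `[0, t]) r.
  rewrite patchE; under eq_Rintegral do rewrite fE.
  by case: ifPn => // _; rewrite /Rintegral integral0_eq.
split.
- apply: (integrable_mkcond _ _).2 => //.
  apply: eq_integrable i1 => // r _; rewrite e1.
  by rewrite !patchE; case: ifPn.
- by apply: eq_integrable i2 => // w _; rewrite e2.
- under eq_Rintegral do rewrite -e2.
  rewrite -e [RHS]Rintegral_mkcond.
  by apply: eq_Rintegral => r _; rewrite e1.
Qed.

End ExpectationItv.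

(** * Real and imaginary parts *)

Section Parts.
Variable R : realType.

(** One Boolean-indexed family, so that a single real argument covers both
    components. *)
Definition part (b : bool) (z : R[i]) : R := if b then complex.Re z else complex.Im z.

Lemma part0 b : part b 0 = 0. Proof. by case: b. Qed.

Lemma partD b z w : part b (z + w) = part b z + part b w.
Proof. by case: b; case: z => ? ?; case: w. Qed.

Lemma partN b z : part b (- z) = - part b z.
Proof. by case: b; case: z. Qed.

Lemma partB b z w : part b (z - w) = part b z - part b w.
Proof. by rewrite partD partN. Qed.

Lemma partMr b z (r : R) : part b (z * r%:C) = part b z * r.
Proof. by case: b; case: z => x y /=; rewrite !(mulr0, subr0, add0r, addr0). Qed.

Lemma part_sum b (I : Type) (s : seq I) (f : I -> R[i]) :
  part b (\sum_(i <- s) f i) = \sum_(i <- s) part b (f i).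
Proof. exact: (big_morph _ (partD b) (part0 b)). Qed.

Lemma part_cintegral b dO (O : measurableType dO) (mu : {measure set O -> \bar R})
  (D : set O) (f : O -> R[i]) :
  part b (cintegral mu D f) = \int[mu]_(x in D) part b (f x).
Proof. by case: b. Qed.

Lemma eq_parts z w : (forall b, part b z = part b w) -> z = w.
Proof.
by case: z => a b; case: w => c d h; have := h true; have := h false => /= -> ->.
Qed.

Lemma le_part_normc b z : `|part b z| <= Normc.normc z.
Proof.
case: z => x y; case: b => /=; rewrite -sqrtr_sqr ler_wsqrtr// ?lerDl ?lerDr sqr_ge0//.
Qed.

Lemma normc_le_parts z : Normc.normc z <= `|part true z| + `|part false z|.
Proof.
case: z => x y /=; rewrite -[leRHS]ger0_norm ?addr_ge0// -sqrtr_sqr ler_wsqrtr//.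
rewrite sqrrD !real_normK ?num_real// addrAC lerDl mulrn_wge0// mulr_ge0//.
Qed.

Lemma normc_ge0 (z : R[i]) : 0 <= Normc.normc z.
Proof. by case: z => x y; exact: sqrtr_ge0. Qed.

Lemma normc_sum (I : Type) (s : seq I) (f : I -> R[i]) :
  Normc.normc (\sum_(i <- s) f i) <= \sum_(i <- s) Normc.normc (f i).
Proof.
elim: s => [|i s ih]; first by rewrite !big_nil Normc.normc0.
by rewrite !big_cons (le_trans (le_normcD _ _))// lerD2l.
Qed.

Lemma cvg_part b (T : Type) (F : set_system T) {FF : Filter F} (f : T -> R[i]^o)
    (l : R[i]^o) : f x @[x --> F] --> l -> part b (f x) @[x --> F] --> part b l.
Proof.
move=> /cvgrPdist_lt fl; apply/cvgrPdist_lt => e e0.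
have e0' : (0 : R[i]) < e%:C by rewrite ltcR.
have := fl _ e0'; apply: filterS => x.
rewrite -partB => h; apply: le_lt_trans (le_part_normc b _) _.
by rewrite -ltcR.
Qed.

Lemma cvg_parts (T : Type) (F : set_system T) {FF : Filter F} (f : T -> R[i]^o)
    (l : R[i]^o) : (forall b, part b (f x) @[x --> F] --> part b l) ->
  f x @[x --> F] --> l.
Proof.
move=> fl; apply/cvgrPdist_lt => e; case: e => e1 e2.
rewrite ltcE /= => /andP[/eqP -> e0].
have e02 : 0 < e1 / 2 by rewrite divr_gt0.
have /cvgrPdist_lt /(_ _ e02) h1 := fl true.
have /cvgrPdist_lt /(_ _ e02) h2 := fl false.
near=> x.
have -> : `|l - f x| = (Normc.normc (l - f x))%:C by [].
rewrite ltcR; apply: le_lt_trans (normc_le_parts _) _.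
rewrite !partB [e1]splitr ltrD//; near: x; assumption.
Unshelve. all: by end_near. Qed.

End Parts.

(** * The pairing of the extended tensor algebra *)

Section Pairing.
Variables (R : realType) (d : nat).
Implicit Types (u : ext_tensorC R d) (x : ext_tensor R d).

(** All multi-indices of length at most [N]: one flat sum over them is easier to
    integrate and to measure than a sum of sums over tuples of varying length. *)
Definition indices_upto (N : nat) : seq (multi_index d) :=
  flatten [seq [seq val t | t <- enum {: n.-tuple 'I_d}] | n <- iota 0 N.+1].

Lemma partial_pairing N u x :
  \sum_(0 <= n < N.+1) level_pairing n u x =
  \sum_(I <- indices_upto N) u I * (x I)%:C.
Proof.
rewrite /indices_upto big_flatten big_map /index_iota subn0.
by apply: eq_bigr => n _; rewrite big_map big_enum.
Qed.

Variable Pi : nat -> set (multi_index d).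
Hypothesis hPi : graded_partition Pi.

(** A level is the sum of the blocks of its length, and blocks of different levels
    are different; so the triangle inequality bounds the levels by finitely many
    distinct terms of the series of the seminorm. *)
Lemma level_block_bound u x N :
  ((\sum_(n < N) Normc.normc (level_pairing n u x))%:E <= seminorm Pi u x)%E.
Proof.
have [Pi0 tPi cPi sPi] := hPi.
have exk I : exists k, Pi k I.
  have : (\bigcup_k Pi k) I by rewrite cPi.
  by case=> k _ ?; exists k.
pose kidx I := sval (cid (exk I)).
have kidxP I : Pi (kidx I) I by rewrite /kidx; case: cid.
have kidxE k I : Pi k I -> kidx I = k.
  by move=> PkI; apply: tPi => //; exists I.
pose sz k := size (sval (cid (Pi0 k))).
have szP k I : Pi k I -> size I = sz k.
  by move=> PkI; apply: (sPi k) => //; rewrite /sz; case: cid.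
pose t I : R[i] := u I * (x I)%:C.
(* a common bound for the numbers of the blocks that meet the first N levels *)
pose M := (\max_(n < N) \max_(I : n.-tuple 'I_d) kidx I).+1.
have kM (n : 'I_N) (I : n.-tuple 'I_d) : (kidx I < M)%N.
  rewrite /M ltnS; apply: leq_trans (leq_bigmax n).
  exact: (leq_bigmax (F := fun I : n.-tuple _ => kidx I)).
pose blk k := \sum_(I \in Pi k) t I.
have blkE (n : 'I_N) k :
    \sum_(I : n.-tuple 'I_d | kidx I == k) t I = if sz k == n then blk k else 0.
  case: ifPn => skn.
    pose r := [seq (tval J : multi_index d)
      | J : n.-tuple 'I_d <- enum {: n.-tuple 'I_d} & kidx (tval J) == k].
    have -> : blk k = \sum_(J <- r) t J.
      rewrite fsbig_seq; last first.
        rewrite map_inj_uniq; first exact/filter_uniq/enum_uniq.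
        by move=> J1 J2 e; exact: val_inj.
      rewrite /blk; apply: eq_fsbigl; apply/seteqP; split => J /=.
        move=> PkJ; have Jn : size J == n by rewrite (szP k).
        apply/mapP; exists (Tuple Jn) => //.
        by rewrite mem_filter mem_enum /= (kidxE _ _ PkJ) eqxx.
      by move=> /mapP[J']; rewrite mem_filter => /andP[/eqP <- _] ->; exact: kidxP.
    by rewrite /r big_map big_filter big_enum_cond.
  rewrite big_pred0// => I; apply/negbTE; apply: contra skn => /eqP kI.
  by rewrite -(szP k I) ?size_tuple// -kI; exact: kidxP.
have lvlE (n : 'I_N) : level_pairing n u x =
    \sum_(k < M) if sz k == n then blk k else 0.
  rewrite /level_pairing.
  rewrite (partition_big (fun I : n.-tuple _ => Ordinal (kM n I)) xpredT)//=.
  by apply: eq_bigr => k _; rewrite -blkE; apply: eq_bigl => I.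
apply: (@le_trans _ _ (\sum_(k < M) (Normc.normc (blk k)))%:E); last first.
  rewrite -sumEFin -(big_mkord xpredT (fun k => (Normc.normc (blk k))%:E)).
  by apply: nneseries_lim_ge => k _ _; rewrite lee_fin normc_ge0.
rewrite lee_fin.
apply: (@le_trans _ _ (\sum_(n < N) \sum_(k < M)
    if sz k == n then Normc.normc (blk k) else 0)).
  apply: ler_sum => n _; rewrite lvlE (le_trans (normc_sum _ _))//.
  by apply: ler_sum => k _; case: ifP => // _; rewrite Normc.normc0.
rewrite exchange_big/=; apply: ler_sum => k _.
rewrite -big_mkcond/=.
have [szN|szN] := ltnP (sz k) N.
  have -> : \sum_(n < N | sz k == n) Normc.normc (blk k) =
      \sum_(n < N | n == Ordinal szN) Normc.normc (blk k).
    by apply: eq_bigl => n; rewrite [RHS]eq_sym.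
  by rewrite big_pred1_eq.
rewrite big_pred0 ?normc_ge0// => n; apply/negbTE/eqP => e.
by have := ltn_ord n; rewrite -e ltnNge szN.
Qed.

Lemma part_level_bound b u x N :
  ((\sum_(n < N) `|part b (level_pairing n u x)|)%:E <= seminorm Pi u x)%E.
Proof.
apply: le_trans (level_block_bound u x N); rewrite lee_fin.
by apply: ler_sum => n _; exact: le_part_normc.
Qed.

(** Absolute convergence over the levels makes [pairing], a total limit, the limit
    of its partial sums. *)
Lemma cvg_pairing b u x : (seminorm Pi u x < +oo)%E ->
  part b (\sum_(I <- indices_upto N) u I * (x I)%:C) @[N --> \oo]
    --> part b (pairing u x).
Proof.
move=> fin.
have [K sK] : exists K : R, (seminorm Pi u x <= K%:E)%E.
  move: fin; case: seminorm => [r _|//|_]; first by exists r.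
  by exists 0; rewrite leNye.
have cv b' : cvgn (series (fun n => part b' (level_pairing n u x))).
  apply: normed_cvg; apply: nondecreasing_is_cvgn.
    by apply: nondecreasing_series => n _ _; exact: normr_ge0.
  exists K => _ [N _ <-]; rewrite -lee_fin; apply: le_trans sK.
  rewrite [X in (X%:E <= _)%E](_ : _ =
      \sum_(n < N) `|part b' (level_pairing n u x)|); last exact: big_mkord.
  exact: part_level_bound.
pose l : R[i]^o := limn (series (fun n => part true (level_pairing n u x)))
   +i* limn (series (fun n => part false (level_pairing n u x))).
have cvl : (fun N => \sum_(0 <= n < N.+1) level_pairing n u x : R[i]^o) @ \oo --> l.
  apply: cvg_parts => b'.
  under eq_fun do rewrite part_sum.
  rewrite (_ : part b' l = limn (series (fun n => part b' (level_pairing n u x)))).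
    have := cv b'; rewrite -(cvg_shiftS (series _)); apply: cvg_trans.
    by apply: near_eq_cvg; near=> N.
  by case: b'.
have -> : pairing u x = l by exact: cvg_lim.
under eq_fun do rewrite -partial_pairing.
exact: cvg_part.
Unshelve. all: by end_near. Qed.

End Pairing.

Section PairingIntegral.
Variables (R : realType) (d : nat).
Implicit Types (u : ext_tensorC R d) (x : ext_tensor R d).

Lemma measurable_part_sum dX (X : measurableType dX) (D : set X) b
    (s : seq (multi_index d)) (u : X -> ext_tensorC R d) (x : X -> ext_tensor R d) :
  (forall I, measurable_fun D (fun z => part b (u z I))) ->
  (forall I, measurable_fun D (fun z => x z I)) ->
  measurable_fun D (fun z => part b (\sum_(I <- s) u z I * (x z I)%:C)).
Proof.
move=> mu mx; under eq_fun do rewrite part_sum.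
apply: measurable_sum => I; under eq_fun do rewrite partMr.
exact: measurable_funM.
Qed.

Lemma integrable_part_sum dX (X : measurableType dX) (m : {measure set X -> \bar R})
    (D : set X) b (s : seq (multi_index d)) (u : X -> ext_tensorC R d) x :
  measurable D ->
  (forall I, m.-integrable D (fun z => (part b (u z I))%:E)) ->
  m.-integrable D (fun z => (part b (\sum_(I <- s) u z I * (x I)%:C))%:E) /\
  \int[m]_(z in D) part b (\sum_(I <- s) u z I * (x I)%:C) =
  \sum_(I <- s) (\int[m]_(z in D) part b (u z I)) * x I.
Proof.
move=> mD iu; elim: s => [|I s [ih1 ih2]].
  under eq_fun do rewrite big_nil part0.
  under eq_Rintegral do rewrite big_nil part0.
  split; first exact: integrable0.
  by rewrite big_nil /Rintegral integral0.
have e z : part b (\sum_(J <- I :: s) u z J * (x J)%:C) =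
    part b (u z I) * x I + part b (\sum_(J <- s) u z J * (x J)%:C).
  by rewrite big_cons partD partMr.
have iI : m.-integrable D (EFin \o (fun z => part b (u z I) * x I)).
  by apply: eq_integrable (integrableZr _ (x I) (iu I)) => // z _; rewrite EFinM.
split.
  apply: eq_integrable (integrableD _ iI ih1) => // z _.
  by rewrite /= e EFinD.
under eq_Rintegral do rewrite e.
by rewrite (RintegralD mD iI ih1) ih2 big_cons (RintegralZr _ mD (iu I)).
Qed.

Variable Pi : nat -> set (multi_index d).
Hypothesis hPi : graded_partition Pi.

Lemma measurable_pairing dX (X : measurableType dX) (D : set X) b
    (u : X -> ext_tensorC R d) (x : X -> ext_tensor R d) :
  (forall I, measurable_fun D (fun z => part b (u z I))) ->
  (forall I, measurable_fun D (fun z => x z I)) ->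
  (forall z, D z -> (seminorm Pi (u z) (x z) < +oo)%E) ->
  measurable_fun D (fun z => part b (pairing (u z) (x z))).
Proof.
move=> mu mx fin.
apply: (@measurable_fun_cvg _ _ _ _ (fun N z =>
   part b (\sum_(I <- indices_upto d N) u z I * (x z I)%:C))).
  by move=> N; exact: measurable_part_sum.
by move=> z Dz; apply: (cvg_pairing hPi); exact: fin.
Qed.

(** The equation holds for the partial sums by linearity. These converge under
    the sum of the absolute values of the levels: it is measurable in the time and
    lies below the seminorm, whose integral is finite. *)
Lemma pairing_ode (T : R) b u (v c : R -> ext_tensorC R d) x :
  (forall I b, lebesgue_measure.-integrable `[0, T] (fun s => (part b (v s I))%:E)) ->
  (forall t, 0 <= t <= T -> forall I,
     c t I = u I + cintegral lebesgue_measure `[0, t] (fun s => v s I)) ->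
  (seminorm Pi u x < +oo)%E ->
  (forall t, 0 <= t <= T -> (seminorm Pi (c t) x < +oo)%E) ->
  (forall t, 0 <= t <= T -> (seminorm Pi (v t) x < +oo)%E) ->
  (\int[lebesgue_measure]_(t in `[0%R, T]) seminorm Pi (v t) x < +oo)%E ->
  lebesgue_measure.-integrable `[0, T] (fun s => (part b (pairing (v s) x))%:E) /\
  forall t, 0 <= t <= T -> part b (pairing (c t) x) = part b (pairing u x) +
    \int[lebesgue_measure]_(s in `[0, t]) part b (pairing (v s) x).
Proof.
move=> iv cE fu fc fv ifv.
pose D s := (\sum_(0 <= n <oo) `|part b (level_pairing n (v s) x)|%:E)%E.
have D0 s : (0 <= D s)%E by apply: nneseries_ge0 => n _ _; rewrite lee_fin.
have mv I b' : measurable_fun `[0, T] (fun s => part b' (v s I)).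
  by apply/measurable_EFinP; case/integrableP: (iv I b').
have mlevel n : measurable_fun `[0, T] (fun s => part b (level_pairing n (v s) x)).
  rewrite (_ : (fun s => _) =
      (fun s => \sum_(I : n.-tuple 'I_d) part b (v s I) * x I)).
    by apply: measurable_sum => I; exact: measurable_funM.
  apply/funext => s; rewrite [LHS]part_sum.
  by apply: eq_bigr => I _; rewrite partMr.
have mD : measurable_fun `[0, T] D.
  apply: ge0_emeasurable_sum => [n s _ _|n _]; first by rewrite lee_fin.
  by apply/measurable_EFinP; exact: measurableT_comp.
have Dle s : (D s <= seminorm Pi (v s) x)%E.
  apply: lime_le; first by apply: is_cvg_nneseries => n _ _; rewrite lee_fin.
  near=> N; rewrite sumEFin big_mkord; exact: part_level_bound.
have iD : lebesgue_measure.-integrable `[0, T] D.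
  apply/integrableP; split => //.
  under eq_integral do rewrite gee0_abs//.
  apply: le_lt_trans ifv; rewrite [leLHS]integral_mkcond [leRHS]integral_mkcond.
  by apply: ge0_le_integral_nonmeasurable => s; rewrite !patchE; case: ifPn.
have bound s N : (`|part b (\sum_(I <- indices_upto d N) v s I * (x I)%:C)|%:E <= D s)%E.
  rewrite -partial_pairing part_sum; apply: le_trans (nneseries_lim_ge N.+1 _).
    by rewrite sumEFin lee_fin; exact: ler_norm_sum.
  by move=> n _ _; rewrite lee_fin.
have mpart N : measurable_fun `[0, T]
    (fun s => part b (\sum_(I <- indices_upto d N) v s I * (x I)%:C)).
  by apply: measurable_part_sum => // I; exact: mv.
have mpair : measurable_fun `[0, T] (fun s => part b (pairing (v s) x)).
  apply: measurable_pairing => // s /=; rewrite in_itv /=; exact: fv.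
have DCT t : t <= T -> 
    lebesgue_measure.-integrable `[0, t] (fun s => (part b (pairing (v s) x))%:E) /\
    \int[lebesgue_measure]_(s in `[0, t])
      part b (\sum_(I <- indices_upto d N) v s I * (x I)%:C) @[N --> \oo]
    --> \int[lebesgue_measure]_(s in `[0, t]) part b (pairing (v s) x).
  move=> tT.
  have sub : `[0, t]%classic `<=` `[0, T]%classic.
    by apply: subset_itvl; rewrite bnd_simp.
  have [] := @dominated_convergence _ _ _ lebesgue_measure `[0, t]%classic
    (measurable_itv _)
    (fun N s => (part b (\sum_(I <- indices_upto d N) v s I * (x I)%:C))%:E)
    (fun s => (part b (pairing (v s) x))%:E) D.
  - by move=> N; apply/measurable_EFinP; exact: measurable_funS (mpart N).
  - by apply/measurable_EFinP; exact: measurable_funS mpair.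
  - apply: aeW => s /sub; rewrite /= in_itv/= => sT.
    by apply: cvg_EFin; [exact: nearW|apply: (cvg_pairing hPi); exact: fv].
  - exact: integrableS iD.
  - by apply: aeW => s N _; exact: bound.
  move=> ip _ cv; split => //.
  by apply: fine_cvg; rewrite fineK//; apply: integrable_fin_num.
split; first by have [] := DCT T (lexx _).
move=> t tT; have [t0 tle] := andP tT.
have [_ cvI] := DCT t tle.
have cvc := @cvg_pairing _ _ _ hPi b _ _ (fc t tT).
have cvu := @cvg_pairing _ _ _ hPi b _ _ fu.
rewrite -(cvg_lim (@Rhausdorff R) cvc); apply: cvg_lim => //.
apply: cvg_trans (cvgD cvu cvI); apply: near_eq_cvg; near=> N => /=.
have sub : `[0, t]%classic `<=` `[0, T]%classic.
  by apply: subset_itvl; rewrite bnd_simp.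
have iv' I : lebesgue_measure.-integrable `[0, t] (fun s => (part b (v s I))%:E).
  by apply: integrableS (iv I b).
have [_ intE] := @integrable_part_sum _ _ lebesgue_measure `[0, t]%classic b
  (indices_upto d N) v x (measurable_itv _) iv'.
rewrite -[LHS]/(part b (\sum_(I <- indices_upto d N) u I * (x I)%:C) +
  \int[lebesgue_measure]_(s in `[0, t])
    part b (\sum_(I <- indices_upto d N) v s I * (x I)%:C)).
rewrite intE !part_sum -big_split/=; apply: eq_bigr => I _.
by rewrite !partMr cE// partD part_cintegral mulrDl.
Unshelve. all: by end_near. Qed.

End PairingIntegral.

(** * Duality *)

Section Duality.
Variables (R : realType) (dO : measure_display) (O : measurableType dO).
Variables (P : probability O R).
Notation mu := (@lebesgue_measure R).

Lemma integrable_ae_dominated (f : O -> R) (D : O -> \bar R) :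
  measurable_fun setT f -> P.-integrable setT D ->
  {ae P, forall w, (`|f w|%:E <= D w)%E} ->
  P.-integrable setT (fun w => (f w)%:E) /\
  (\int[P]_w `|f w|%:E <= \int[P]_w D w)%E.
Proof.
move=> mf iD fD; have mD : measurable_fun setT D by case/integrableP: iD.
have le1 : (\int[P]_w `|f w|%:E <= \int[P]_w `|D w|)%E.
  apply: ae_ge0_le_integral => //.
  - by apply/measurable_EFinP; exact: measurableT_comp.
  - exact: measurableT_comp.
  - by apply: filterS fD => w h _; apply: le_trans h (lee_abs _).
have e : (\int[P]_w `|D w| = \int[P]_w D w)%E.
  apply: ae_eq_integral => //; first exact: measurableT_comp.
  apply: filterS fD => w h _; rewrite gee0_abs//; apply: le_trans h.
  by rewrite lee_fin.
split; last by rewrite -e.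
apply/integrableP; split; first exact/measurable_EFinP.
by apply: le_lt_trans le1 _; case/integrableP: iD.
Qed.

(** The expectations of [a] and [b] satisfy [diagonal_identity]. The hypotheses
    are those of a family extended to the whole line: by zero in the first
    variable, in which only measurability is available, and by [clamp] in the
    second, in order to keep right continuity. *)
Lemma expectation_duality (T K : R) (a b : R -> R -> O -> R) : 0 < T ->
  (forall t, measurable_fun setT (fun z : R * O => b z.1 t z.2)) ->
  (forall s t w, ~~ (0 <= s <= T) -> b s t w = 0) ->
  (forall s w t, b s r w @[r --> t^'+] --> b s t w) ->
  (forall s, exists D : O -> \bar R, [/\ P.-integrable setT D,
     (\int[P]_w D w <= K%:E)%E
     & {ae P, forall w t, (`|b s t w|%:E <= D w)%E}]) ->
  (forall s t, 0 <= s <= T -> 0 <= t <= T ->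
     P.-integrable setT (fun w => (a s t w)%:E)) ->
  (forall s t w, 0 <= s <= T -> 0 <= t <= T ->
     a s t w = a 0 t w + \int[mu]_(r in `[0, s]) b r t w) ->
  (forall s t, 0 <= s <= T -> 0 <= t <= T ->
     \int[P]_w (a s t w - a s 0 w - \int[mu]_(r in `[0, t]) b s r w) = 0) ->
  \int[P]_w a 0 T w = \int[P]_w a T 0 w.
Proof.
move=> T0 mb b0 rb bD ia a1 a2.
pose h s t := \int[P]_w b s t w.
have mb1 s t : measurable_fun setT (b s t).
  exact: (measurableT_comp (mb t) (measurable_pair1 s)).
have ibK s t : P.-integrable setT (fun w => (b s t w)%:E) /\
    (\int[P]_w `|b s t w|%:E <= K%:E)%E.
  have [D [iD DK bDs]] := bD s.
  have [|i1 i2] := integrable_ae_dominated (mb1 s t) iD.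
    by apply: filterS bDs => w.
  by split => //; exact: le_trans DK.
have hK s t : `|h s t| <= K.
  have [i1 i2] := ibK s t; rewrite -lee_fin; apply: le_trans i2.
  rewrite /h EFin_normr_Rintegral//; apply: le_abse_integral => //.
  exact/measurable_EFinP.
(* h is measurable in s by Fubini and right-continuous in t by domination, hence
   jointly measurable *)
have hr s t : h s r @[r --> t^'+] --> h s t.
  apply/cvg_at_rightP => q [qt cq]; have [D [iD _ bDs]] := bD s.
  have [] := @dominated_convergence _ _ _ P setT measurableT
    (fun n w => (b s (q n) w)%:E) (fun w => (b s t w)%:E) D.
  - by move=> n; exact/measurable_EFinP.
  - exact/measurable_EFinP.
  - apply: aeW => w _; apply: cvg_EFin; first exact: nearW.
    by have /cvg_at_rightP := rb s w t; apply.
  - exact: iD.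
  - by apply: filterS bDs => w hw n _; exact: hw.
  move=> i1 _ cv; apply: fine_cvg; rewrite fineK//.
  by apply: integrable_fin_num.
have e1 s t := @expectation_Rintegral_itv R dO O P (fun r => b r t) K s (mb t)
  (fun r _ => (ibK r t).2).
have mb2 s : measurable_fun setT (fun z : R * O => b s z.1 z.2).
  exact: measurable_right_continuous.
have e2 s t := @expectation_Rintegral_itv R dO O P (b s) K t (mb2 s)
  (fun r _ => (ibK s r).2).
have mh1 t : measurable_fun setT (fun s => h s t).
  have -> : (fun s => h s t) = (fun s => h s t) \_ `[0, T].
    apply/funext => s; rewrite patchE; case: ifPn => //.
    rewrite notin_setE/= in_itv/= => /negP s0.
    rewrite /h /Rintegral integral0_eq// => w _.
    by rewrite b0.
  apply/(@measurable_restrictT _ _ _ _ `[0, T]%classic _ (measurable_itv _)).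
  apply/measurable_EFinP.
  by have [i1 _ _] := e1 T t; case/integrableP: i1.
have mh : measurable_fun setT (fun z : R * R => h z.1 z.2).
  have mh' := @measurable_right_continuous R _ _ (fun t s => h s t)
    (fun s t => hr s t) mh1.
  exact: (measurableT_comp mh' (@measurable_swap _ _ R R)).
apply: (diagonal_identity (G := fun s t => \int[P]_w a s t w) T0 mh hK) => s t sT tT.
- have [_ i2 e] := e1 s t.
  have T00 : 0 <= (0 : R) <= T by rewrite lexx ltW.
  rewrite -e -(RintegralD _ (ia 0 t T00 tT) i2)//.
  by apply: eq_Rintegral => w _; exact: a1.
- have [_ i2 e] := e2 s t.
  have T00 : 0 <= (0 : R) <= T by rewrite lexx ltW.
  have := a2 s t sT tT.
  have i3 : P.-integrable setT (fun w => (a s t w - a s 0 w)%:E).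
    apply: eq_integrable (integrableB _ (ia s t sT tT) (ia s 0 sT T00)) => // w _.
  rewrite (RintegralB _ i3 i2)// (RintegralB _ (ia s t sT tT) (ia s 0 sT T00))//.
  by rewrite e => /eqP; rewrite subr_eq0 subr_eq addrC => /eqP.
Qed.

End Duality.

(** * Polynomial processes *)

Section Process.
Variables (R : realType) (d : nat) (S : set (ext_tensor R d)).
Variables (dO : measure_display) (O : measurableType dO).
Variables (P : probability O R) (T : R).

Lemma measurable_coordinate (X : R -> O -> S) (I : multi_index d) t :
  S_process T X -> 0 <= t <= T -> measurable_fun setT (fun w => \val (X t w) I).
Proof.
move=> pX tT _ B mB; rewrite setTI.
apply: (pX t tT (fun x : S => B (\val x I))).
exists (fun x : ext_tensor R d => B (x I)); last by rewrite setTI.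
apply: sub_sigma_algebra; exists I => //.
by exists B => //; rewrite setTI.
Qed.

Lemma measurable_evaluation (Pi : nat -> set (multi_index d)) u b
    (X : R -> O -> S) t :
  graded_partition Pi -> dual_set Pi S u -> S_process T X -> 0 <= t <= T ->
  measurable_fun setT (fun w => part b (evaluation u (X t w))).
Proof.
move=> hPi uS pX tT; apply: (measurable_pairing hPi) => [I|I|w _].
- exact: measurable_cst.
- exact: measurable_coordinate.
- exact/uS/set_valP.
Qed.

(** The constant [K] serves all [s]: it bounds the expectations of [b] in
    [expectation_duality] uniformly, although the dominating functions depend on
    [s]. *)
Lemma sup_evaluation_domination (Pi : nat -> set (multi_index d))
    (e : R -> ext_tensorC R d) b (X Y : R -> O -> S) : 0 < T ->
  graded_partition Pi -> (forall s, 0 <= s <= T -> dual_set Pi S (e s)) ->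
  S_process T X -> version P T X Y ->
  (forall s w, 0 <= s <= T -> cadlag T (fun t => evaluation (e s) (Y t w))) ->
  (\int[P]_w ereal_sup [set (Normc.normc (evaluation (e st.1) (X st.2 w)))%:E
     | st in `[0%R, T] `*` `[0%R, T]] < +oo)%E ->
  exists K : R, forall s, 0 <= s <= T -> exists D : O -> \bar R,
    [/\ P.-integrable setT D, (\int[P]_w D w <= K%:E)%E
     & {ae P, forall w t, 0 <= t <= T ->
         (`|part b (evaluation (e s) (Y t w))|%:E <= D w)%E}].
Proof.
move=> T0 hPi eS pX XY cad.
set B := (fun w => ereal_sup _) => Bfin.
have Bub s t w : 0 <= s <= T -> 0 <= t <= T ->
    ((Normc.normc (evaluation (e s) (X t w)))%:E <= B w)%E.
  by move=> sT tT; apply: ereal_sup_ubound; exists (s, t).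
have T00 : 0 <= (0 : R) <= T by rewrite lexx ltW.
have B0 w : (0 <= B w)%E.
  by apply: (le_trans _ (Bub 0 0 w T00 T00)); rewrite lee_fin normc_ge0.
have IB0 : (0 <= \int[P]_w B w)%E by exact: integral_ge0.
exists (fine (\int[P]_w B w)%E) => s sT.
have [|||||D [iD DB bD]] := @sup_domination R dO O P T
  (fun t w => part b (evaluation (e s) (Y t w)))
  (fun t w => part b (evaluation (e s) (X t w))) B T0.
- by move=> w t tT; apply: cvg_part; have [h _] := cad s w sT; exact: h.
- by move=> t tT; apply: (measurable_evaluation b hPi) => //; exact: eS.
- by move=> t tT; apply: filterS (XY t tT) => w ->.
- move=> t w tT; apply: (le_trans _ (Bub s t w sT tT)).
  by rewrite lee_fin le_part_normc.
- exact: Bfin.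
exists D; split => //.
by rewrite fineK// ge0_fin_numE.
Qed.

End Process.

Theorem theorem3p15 (R : realType) (d : nat) (hd : (0 < d)%N)
  (Pi : nat -> set (multi_index d)) (hPi : graded_partition Pi)
  (S : set (ext_tensor R d))
  (U : set (ext_tensorC R d))
  (hU : linear_subset U) (hUS : U `<=` dual_set Pi S)
  (Lop : (S -> R[i]^o) -> (S -> R[i]^o))
  (L : ext_tensorC R d -> ext_tensorC R d)
  (hL : polynomial_type Pi U Lop L)
  (dO : measure_display) (O : measurableType dO) (P : probability O R)
  (T : R) (hT : 0 < T)
  (F : R -> set_system O) (hF : right_continuous_filtration T F)
  (X : R -> O -> S) (x0 : S)
  (hX : polynomial_process P T F U Lop X x0)
  (u : ext_tensorC R d) (hu : U u)
  (c : R -> ext_tensorC R d)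
  (hc : linear_ode_solution U L T u c)
  (hcL : forall x, S x ->
    (\int[lebesgue_measure]_(t in `[0%R, T]) seminorm Pi (L (c t)) x < +oo)%E)
  (hsup : (\int[P]_w ereal_sup
      [set (Normc.normc (evaluation (c st.1) (X st.2 w)))%:E
        | st in `[0%R, T] `*` `[0%R, T]] < +oo)%E)
  (hsupL : (\int[P]_w ereal_sup
      [set (Normc.normc (evaluation (L (c st.1)) (X st.2 w)))%:E
        | st in `[0%R, T] `*` `[0%R, T]] < +oo)%E) :
  cintegrable P setT (fun w => evaluation u (X T w)) /\
  cintegral P setT (fun w => evaluation u (X T w)) = evaluation (c T) x0.
Proof.
have [cU iLc cE] := hc.
have [_ hL2] := hL.
have [pX X0 [Y [pY XY regY martY]]] := hX.
have T00 : 0 <= (0 : R) <= T by rewrite lexx ltW.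
have TT : 0 <= T <= T by rewrite lexx ltW.
pose v s := L (c s).
have cS s : 0 <= s <= T -> dual_set Pi S (c s) by move=> /cU; exact: hUS.
have vS s : 0 <= s <= T -> dual_set Pi S (v s) by move=> /cU /hL2[].
have LopE s x : 0 <= s <= T -> Lop (evaluation (c s)) x = evaluation (v s) x.
  by move=> /cU /hL2[_]; apply.
have dom s : 0 <= s <= T -> polynomial_domain U (evaluation (S := S) (c s)).
  by move=> sT; exists (c s) => //; exact: cU.
have cadc s w : 0 <= s <= T -> cadlag T (fun t => evaluation (c s) (Y t w)).
  by move=> sT; have [_ h _ _] := regY _ (dom s sT).
have cadv s w : 0 <= s <= T -> cadlag T (fun t => evaluation (v s) (Y t w)).
  move=> sT; have [_ _ _ h] := regY _ (dom s sT).
  rewrite (_ : (fun t => _) = (fun t => Lop (evaluation (c s)) (Y t w)))//.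
  by apply/funext => t; rewrite LopE.
have c0 : c 0 = u.
  apply/funext => J; apply: eq_parts => p; rewrite cE// partD part_cintegral.
  by rewrite set_itv1 Rintegral_set1 addr0.
suff main p : P.-integrable setT (fun w => (part p (evaluation u (X T w)))%:E) /\
    \int[P]_w part p (evaluation u (X T w)) = part p (evaluation (c T) x0).
  split; first by split; [exact: (main true).1|exact: (main false).1].
  by apply: eq_parts => p; rewrite part_cintegral (main p).2.
have [Ka domA] := sup_evaluation_domination p hT hPi cS pX XY cadc hsup.
have [Kb domB] := sup_evaluation_domination p hT hPi vS pX XY cadv hsupL.
pose a s t w := part p (evaluation (c s) (Y t w)).
pose b s t w :=
  if 0 <= s <= T then part p (evaluation (v s) (Y (clamp T t) w)) else 0.
have cT t : 0 <= clamp T t <= T by exact: clamp_itv (ltW hT).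
have ma s t : 0 <= s <= T -> 0 <= t <= T -> measurable_fun setT (a s t).
  by move=> sT tT; apply: (measurable_evaluation p hPi (cS s sT) pY tT).
have ia s t : 0 <= s <= T -> 0 <= t <= T -> P.-integrable setT (fun w => (a s t w)%:E).
  move=> sT tT; have [D [iD _ bD]] := domA s sT.
  have [|//] := integrable_ae_dominated (ma s t sT tT) iD.
  by apply: filterS bD => w; exact.
have Kb0 : 0 <= Kb.
  have [D [iD DK bD]] := domB 0 T00; rewrite -lee_fin; apply: le_trans DK.
  have [|_ ] := integrable_ae_dominated
     (measurable_evaluation p hPi (vS 0 T00) pY T00) iD.
    by apply: filterS bD => w; exact.
  by apply: le_trans; apply: integral_ge0 => w _; rewrite lee_fin.
have mv I p' : measurable_fun `[0, T] (fun s => part p' (v s I)).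
  have [i1 i2] := iLc I; apply/measurable_EFinP.
  by case: p'; [case/integrableP: i1|case/integrableP: i2].
have mb t : measurable_fun setT (fun z : R * O => b z.1 t z.2).
  have mD : measurable (`[0, T]%classic `*` [set: O] : set (R * O)).
    exact: measurableX.
  rewrite (_ : (fun z => _) =
    (fun z : R * O => part p (pairing (v z.1) (\val (Y (clamp T t) z.2))))
      \_ (`[0, T] `*` setT)); last first.
    apply/funext => -[s w]; rewrite patchE in_setX /= in_setT andbT /b.
    have -> // : (s \in `[0, T]%classic) = (0 <= s <= T).
    by apply/idP/idP; rewrite inE /= in_itv.
  apply/(measurable_restrictT _ mD); apply: (measurable_pairing hPi) => [I|I|].
  - apply: (measurable_comp (F := `[0, T]%classic)
      (f := fun s => part p (v s I)) (g := fst)) => //.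
    + by move=> _ [[s w] [/= h _] <-].
    + exact: measurable_funS measurable_fst.
  - apply: (measurable_funS measurableT) => //.
    exact: (measurableT_comp (measurable_coordinate I pY (cT t)) measurable_snd).
  - by move=> [s w] [/= sT _]; apply: vS; [rewrite in_itv in sT|exact: set_valP].
have rb s w t : b s r w @[r --> t^'+] --> b s t w.
  rewrite /b; case: ifPn => sT; last exact: cvg_cst.
  apply: (@clamp_right_continuous R T
    (fun t => part p (evaluation (v s) (Y t w))) hT) => {}t tT.
  by apply: cvg_part; have [h _] := cadv s w sT; exact: h.
have bD s : exists D : O -> \bar R, [/\ P.-integrable setT D,
     (\int[P]_w D w <= Kb%:E)%E & {ae P, forall w t, (`|b s t w|%:E <= D w)%E}].
  have [sT|sT] := boolP (0 <= s <= T).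
    have [D [iD DK bD]] := domB s sT; exists D; split => //.
    by apply: filterS bD => w h t; rewrite /b sT; exact: h.
  exists (cst 0%E); split.
  - exact: integrable0.
  - by rewrite integral0 lee_fin.
  - by apply: aeW => w t; rewrite /b (negbTE sT) normr0.
have bE s r w : 0 <= s <= T -> 0 <= r <= T ->
    b s r w = part p (evaluation (v s) (Y r w)).
  by move=> sT rT; rewrite /b sT clamp_id.
(* the evolution in s *)
have ode s t w : 0 <= s <= T -> 0 <= t <= T ->
    a s t w = a 0 t w + \int[lebesgue_measure]_(r in `[0, s]) b r t w.
  move=> sT tT; have SY : S (\val (Y t w)) by exact: set_valP.
  have [||||||_ h] := @pairing_ode R d Pi hPi T p u v c (\val (Y t w)).
  - by move=> I []; [exact: (iLc I).1|exact: (iLc I).2].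
  - by move=> r rT J; exact: cE.
  - exact: hUS.
  - by move=> r rT; exact: cS.
  - by move=> r rT; exact: vS.
  - exact: hcL.
  rewrite /a c0 [LHS](h s sT); congr (_ + _); apply: eq_Rintegral => r.
  rewrite inE/= in_itv/= => /andP[r0 rs]; rewrite bE//.
  by rewrite r0 (le_trans rs)//; case/andP: sT.
(* the evolution in t *)
have mean s t : 0 <= s <= T -> 0 <= t <= T ->
    \int[P]_w (a s t w - a s 0 w -
      \int[lebesgue_measure]_(r in `[0, t]) b s r w) = 0.
  move=> sT tT.
  pose f : S -> R[i]^o := evaluation (c s).
  pose M t w := part p (compensated f (Lop f) Y t w).
  have ME r w : 0 <= r <= T -> M r w = a s r w - a s 0 w -
      \int[lebesgue_measure]_(r in `[0, r]) b s r w.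
    move=> rT; rewrite /M /compensated !partB part_cintegral; congr (_ - _).
    apply: eq_Rintegral => q; rewrite inE/= in_itv/= => /andP[q0 qr].
    rewrite LopE// bE// q0 (le_trans qr)//; by case/andP: rT.
  have lM : local_martingale P T F M.
    have [l1 l2] := martY _ (dom s sT).
    by rewrite /M; case: (p).
  have M0 w : M 0 w = 0.
    by rewrite ME// subrr sub0r set_itv1 Rintegral_set1 oppr0.
  have [DA [iDA _ bDA]] := domA s sT.
  have [DB [iDB _ bDB]] := bD s.
  have iD : P.-integrable setT (fun w => (DA w + DA w) + T%:E * DB w)%E.
    apply: integrableD => //; first exact: integrableD.
    exact: integrableZl.
  have bM : {ae P, forall w r, 0 <= r <= T ->
      (`|M r w|%:E <= (DA w + DA w) + T%:E * DB w)%E}.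
    apply: filterS2 bDA bDB => w ha hb r rT.
    have [r0 rleT] := andP rT.
    rewrite ME//.
    (* DB w may be infinite: then the bound is trivial, since 0 < T *)
    have intb : (`|\int[lebesgue_measure]_(q in `[0, r]) b s q w|%:E <= T%:E * DB w)%E.
      case DBw : (DB w) => [k| |].
      - rewrite DBw in hb; have hb' q : `|b s q w| <= k by rewrite -lee_fin hb.
        have k0 : 0 <= k by exact: le_trans (hb' 0).
        have mbw : measurable_fun setT (b s ^~ w).
          have mbs := @measurable_right_continuous R _ O (b s) (rb s)
            (fun q => measurableT_comp (mb q) (measurable_pair1 s)).
          exact: (measurableT_comp mbs (measurable_pair2 w)).
        have := @Rintegral_itv_lipschitz R (b s ^~ w) k r 0 mbw hb' r0 (lexx _).
        rewrite set_itv1 Rintegral_set1 !subr0 (ger0_norm r0) => h.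
        rewrite -EFinM lee_fin (le_trans h)// mulrC ler_wpM2r//.
      - by rewrite gt0_muley ?leey// lte_fin.
      - by have := hb 0; rewrite DBw leeNy_eq.
    apply: le_trans (_ : (`|a s r w|%:E + `|a s 0 w|%:E +
      `|\int[lebesgue_measure]_(q in `[0, r]) b s q w|%:E <= _)%E); last first.
      by rewrite !leeD// ?ha.
    rewrite -!EFinD lee_fin (le_trans (ler_normB _ _))// lerD2r.
    exact: ler_normB.
  have := local_martingale_expectation hT hF lM M0 iD bM tT.
  by under eq_Rintegral do rewrite ME//.
have dual := expectation_duality hT mb _ rb bD ia ode mean.
have mX := measurable_evaluation p hPi (hUS _ hu) pX TT.
have iY : P.-integrable setT (fun w => (part p (evaluation u (Y T w)))%:E).
  by have := ia 0 T T00 TT; rewrite /a c0.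
have mY : measurable_fun setT (fun w => part p (evaluation u (Y T w))).
  by apply/measurable_EFinP; case/integrableP: iY.
have aeXY : ae_eq P setT (fun w => (part p (evaluation u (Y T w)))%:E)
    (fun w => (part p (evaluation u (X T w)))%:E).
  by apply: filterS (XY T TT) => w -> _.
split.
  have [|//] := integrable_ae_dominated mX (integrable_norm iY).
  by apply: filterS aeXY => w /(_ Logic.I) [e]; rewrite /= e.
transitivity (\int[P]_w a 0 T w).
  rewrite /a c0; congr fine; apply/esym; apply: ae_eq_integral => //.
    exact/measurable_EFinP.
  exact/measurable_EFinP.
rewrite dual; last first.
  by move=> s t w /negbTE sT; rewrite /b sT.
transitivity (\int[P]_w part p (evaluation (c T) x0)).
  congr fine; apply: ae_eq_integral => //.
  - by apply/measurable_EFinP; exact: ma.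
  - by apply: filterS2 X0 (XY 0 T00) => w e1 e2 _; rewrite /a e2 e1.
rewrite Rintegral_cst// -[RHS]mulr1; congr (_ * _).
exact: (congr1 fine (@probability_setT _ _ _ P)).
Qed.
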